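(* Suppose that $u\in C(\mathbb{H})$ is bounded from below. Let $\Gamma u$ be the h-convex envelope of $u$, $$(\Gamma u)(p)=\sup\{v(p): v\text{ is h-convex and }v\le u\text{ in }\mathbb{H}\},\qquad p\in\mathbb{H},$$ and let $U(p)=\lim_{n\to\infty}S^n[u](p)$ for $p\in\mathbb{H}$, where $S^n$ is the $n$-fold iterate of the operator $S$. Then $\Gamma u\equiv U$ in $\mathbb{H}$.
   Context: The Heisenberg group $\mathbb{H}$ is $\mathbb{R}^3$ with the group law $(x_p,y_p,z_p)\cdot(x_q,y_q,z_q)=\left(x_p+x_q,\,y_p+y_q,\,z_p+z_q+\tfrac12(x_py_q-x_qy_p)\right)$; $p^{-1}=-p$. Let $\mathbb{H}_0=\{(x,y,0):x,y\in\mathbb{R}\}$, and for $p\in\mathbb{H}$ let $\mathbb{H}_p=\{p\cdot h:h\in\mathbb{H}_0\}$ be the horizontal plane through $p$. An upper semicontinuous function $v:\mathbb{H}\to\mathbb{R}$ is h-convex in $\mathbb{H}$ if $v(p\cdot h^{-1})+v(p\cdot h)\ge2v(p)$ for all $p\in\mathbb{H}$, $h\in\mathbb{H}_0$. For an upper semicontinuous $u:\mathbb{H}\to\mathbb{R}$ bounded from below, $$S[u](p)=\inf\Big\{\sum_{i=1}^3c_iu(p_i):\ c_i\in[0,1],\ p_i\in\mathbb{H}_p\ (i=1,2,3),\ \sum_ic_i=1,\ \sum_ic_ip_i=p\Big\},$$ where linear combinations of points are taken in the vector space $\mathbb{R}^3$. One has $\inf u\le S[u]\le u$ and $S[u]$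 is again upper semicontinuous, so the iterates $S^n[u]$ are defined and nonincreasing in $n$, and the pointwise limit $U$ exists. *)

(* Defs.v *)
From mathcomp Require Import all_boot all_order all_algebra.
From mathcomp Require Import all_classical all_reals all_analysis.
Import Order.TTheory GRing.Theory Num.Theory.
Import numFieldNormedType.Exports.
Set Implicit Arguments.
Unset Strict Implicit.
Unset Printing Implicit Defensive.
Local Open Scope classical_set_scope.
Local Open Scope ring_scope.

(* The coordinates (x, y, z) are the entries of index 0, 1, 2; the native
   addition and scaling of 'rV[R]_3 are the vector-space operations of R^3,
   not the group law hmul. *)
Notation heis R := 'rV[R]_3.

Section Heisenberg.
Variable R : realType.
Implicit Types (p q h : heis R) (u v : heis R -> R).

Definition hx p : R := p ord0 (@Ordinal 3 0 isT).
Definition hy p : R := p ord0 (@Ordinal 3 1 isT).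
Definition hz p : R := p ord0 (@Ordinal 3 2 isT).

Definition hpoint (x y z : R) : heis R := \row_(j < 3) [:: x; y; z]`_j.

Definition hmul p q : heis R :=
  hpoint (hx p + hx q) (hy p + hy q)
         (hz p + hz q + 2^-1 * (hx p * hy q - hx q * hy p)).

Definition hinv p : heis R := - p.

Definition hplane0 : set (heis R) := [set h | exists x y, h = hpoint x y 0].

Definition hplane p : set (heis R) := hmul p @` hplane0.

Definition upper_semicontinuous v : Prop :=
  forall p (a : R), v p < a -> \forall q \near p, v q < a.

Definition hconvex v : Prop :=
  upper_semicontinuous v /\
  forall p h, hplane0 h -> 2 * v p <= v (hmul p (hinv h)) + v (hmul p h).

(* Real-valued sup and inf are harmless below: for u bounded from below, the
   sets are nonempty (constants <= u; p_1 = p_2 = p_3 = p) and bounded on the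
   relevant side (by u p; by any lower bound of u). *)
Definition hconvex_envelope u p : R :=
  sup [set v p | v in [set v | hconvex v /\ forall q, v q <= u q]].

Definition hS u p : R :=
  inf [set y | exists (c : 'I_3 -> R) (q : 'I_3 -> heis R),
        [/\ forall i, 0 <= c i <= 1,
            forall i, hplane p (q i),
            \sum_i c i = 1,
            \sum_i c i *: q i = p &
            y = \sum_i c i * u (q i)]].

Definition hS_limit u p : R := limn (fun n : nat => iter n hS u p).

End Heisenberg.

(* Main.v *)
(* The limit U is upper semicontinuous (an infimum of such functions), h-convex
   (S tests the midpoint of every horizontal segment) and <= u, hence a
   competitor in the definition of the envelope.  It is the largest one because
   an h-convex v satisfies v <= S[v].  This is not immediate, since h-convexity
   only concerns the lines of the plane H_p through p: it amounts to a horizontal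
   subgradient at p.  One perturbs p to a near-maximizer q of v - psi, psi being
   a steep quadratic penalty centred at p.  For h horizontal and t small,
   q = (q.(-th)).(th), so convexity along this line together with maximality
   bounds v(q) by v(p.h) plus a term linear in h; the linear terms cancel in a
   combination with barycenter 0. *)
Require Import Defs.
From mathcomp Require Import all_boot all_order all_algebra.
From mathcomp Require Import all_classical all_reals all_analysis.
From mathcomp Require Import ring lra.
Import Order.TTheory GRing.Theory Num.Theory.
Import numFieldNormedType.Exports.
Local Open Scope classical_set_scope.
Local Open Scope ring_scope.

(** * Coordinates, horizontal translations and neighbourhoods *)

Section Coordinates.
Context {R : realType}.
Implicit Types (p q h : heis R) (a b r : R).

Lemma hxE x y z : hx (hpoint x y z : heis R) = x.
Proof. by rewrite /hx mxE. Qed.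

Lemma hyE x y z : hy (hpoint x y z : heis R) = y.
Proof. by rewrite /hy mxE. Qed.

Lemma hzE x y z : hz (hpoint x y z : heis R) = z.
Proof. by rewrite /hz mxE. Qed.

Definition hcoordE := (hxE, hyE, hzE).

Lemma ord3P (j : 'I_3) :
  [\/ j = @Ordinal 3 0 isT, j = @Ordinal 3 1 isT | j = @Ordinal 3 2 isT].
Proof.
by case: j => -[|[|[|//]]] ?; [constructor 1|constructor 2|constructor 3];
  exact: val_inj.
Qed.

Lemma heis_eqP p q : hx p = hx q -> hy p = hy q -> hz p = hz q -> p = q.
Proof. by move=> ex ey ez; apply/rowP => j; have [->|->|->] := ord3P j. Qed.

Lemma hmul_planeE p a b :
  hmul p (hpoint a b 0) =
  hpoint (hx p + a) (hy p + b) (hz p + 2^-1 * (hx p * b - a * hy p)).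
Proof. by rewrite /hmul !hcoordE addr0. Qed.

Lemma hinv_planeE a b : hinv (hpoint a b 0) = hpoint (- a) (- b) 0 :> heis R.
Proof.
by apply: heis_eqP; rewrite ?hcoordE /hx /hy /hz !mxE //= oppr0.
Qed.

Lemma hmul_plane0 p : hmul p (hpoint 0 0 0) = p.
Proof. by rewrite hmul_planeE; apply: heis_eqP; rewrite hcoordE; ring. Qed.

(** Parallel horizontal vectors commute: the antisymmetric term of the group law vanishes on them,
    so each horizontal line is a one-parameter orbit. *)
Lemma hmul_planeD p a b (s t : R) :
  hmul (hmul p (hpoint (s * a) (s * b) 0)) (hpoint (t * a) (t * b) 0) =
  hmul p (hpoint ((s + t) * a) ((s + t) * b) 0).
Proof.
by rewrite !hmul_planeE; apply: heis_eqP; rewrite !hcoordE; field.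
Qed.

Definition hbox p r : set (heis R) :=
  [set q | [/\ `|hx q - hx p| < r, `|hy q - hy p| < r & `|hz q - hz p| < r]].

Lemma nbhs_hboxP p (A : set (heis R)) :
  nbhs p A <-> exists2 r, 0 < r & hbox p r `<=` A.
Proof.
split=> [/nbhs_ballP[r /= r0 rA]|[r r0 rA]].
  exists r => // q [qx qy qz]; apply: rA; rewrite /ball /=.
  by split=> // i j; rewrite (ord1 i) /ball /= distrC; have [->|->|->] := ord3P j.
apply/nbhs_ballP; exists r => // q [_ pq]; apply: rA.
by split; rewrite distrC; apply: pq.
Qed.

(** Right translation by a fixed horizontal vector is Lipschitz; this carries upper semicontinuity
    at a displaced point back to the base point. *)
Lemma near_hmul_plane h a b (A : set (heis R)) :
  nbhs (hmul h (hpoint a b 0)) A -> \forall p \near h, A (hmul p (hpoint a b 0)).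
Proof.
move=> /nbhs_hboxP[r r0 rA]; apply/nbhs_hboxP.
(* A Lipschitz constant in the sup norm: the vertical coordinate picks up at most half of the sum of
   the absolute values of [a] and [b], times the radius. *)
pose K := 1 + `|a| + `|b|.
have [a0 b0] : 0 <= `|a| /\ 0 <= `|b| by [].
have K1 : 1 <= K by rewrite /K; lra.
have K0 : 0 < K by lra.
exists (r / K); first by rewrite divr_gt0.
have rK : r / K * K = r by rewrite divfK ?gt_eqF.
set s := r / K in rK *.
move=> q [qx qy qz]; apply: rA; rewrite !hmul_planeE; split; rewrite !hcoordE.
- by rewrite (_ : _ - _ = hx q - hx h); [nra|ring].
- by rewrite (_ : _ - _ = hy q - hy h); [nra|ring].
rewrite (_ : _ - _ = (hz q - hz h) + 2^-1 * ((hx q - hx h) * b - a * (hy q - hy h))); last by field.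
set X := hx q - hx h in qx *; set Y := hy q - hy h in qy *.
have bX : `|X * b| <= s * `|b| by rewrite normrM ler_wpM2r // ltW.
have aY : `|a * Y| <= `|a| * s by rewrite normrM ler_wpM2l // ltW.
move: bX aY qz; rewrite !ler_norml !ltr_norml /K in rK *; nra.
Qed.

End Coordinates.

(** * h-convexity on horizontal planes, and the operator [hS] *)

Section HConvex.
Context {R : realType}.
Implicit Types (p q h : heis R) (u v w : heis R -> R).

(* Dyadic times suffice below, so Jensen's inequality for arbitrary weights,
   which would use semicontinuity, is not needed. *)
Lemma hconvex_dyadic v q (a b : R) k : hconvex v ->
  v (hmul q (hpoint (2 ^- k * a) (2 ^- k * b) 0)) <=
  (1 - 2 ^- k) * v q + 2 ^- k * v (hmul q (hpoint a b 0)).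
Proof.
move=> [_ vconv]; elim: k => [|k IH]; first by rewrite expr0 invr1 !mul1r; lra.
set s := 2 ^- k.+1.
have ks : 2 ^- k = s + s by rewrite /s exprS invfM; lra.
(* The point at time [s] is the midpoint of [q] and the point at time [2 ^- k], where the induction
   hypothesis applies. *)
have := vconv (hmul q (hpoint (s * a) (s * b) 0)) (hpoint (s * a) (s * b) 0).
rewrite hinv_planeE -!mulNr !hmul_planeD subrr !mul0r hmul_plane0 -ks.
move=> /(_ (ex_intro _ _ (ex_intro _ _ erefl))).
rewrite ks in IH *; lra.
Qed.

Lemma near_exp2N (A e : R) : 0 < e -> \forall k \near \oo, 2 ^- k * A <= e.
Proof.
move=> e0.
have : (fun k => 2 ^- k * A) @ \oo --> 0 * A.
  apply: cvgMl; under eq_fun do rewrite -exprVn.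
  by apply: cvg_expr; rewrite ger0_norm; lra.
by rewrite mul0r => /cvgr_le; apply.
Qed.

Lemma hconvex_barycenter n v p (c a b : 'I_n -> R) : hconvex v ->
  (forall i, 0 <= c i) -> \sum_i c i = 1 ->
  \sum_i c i * a i = 0 -> \sum_i c i * b i = 0 ->
  v p <= \sum_i c i * v (hmul p (hpoint (a i) (b i) 0)).
Proof.
move=> vconv c0 c1 ca0 cb0; have [vusc _] := vconv.
(* Two of the three [d] are spent in [vq0], the third on near-maximality, as [t ^+ 2 <= t <= d]. *)
apply/ler_addgt0Pr => e e0; pose d := e / 3.
have d0 : 0 < d by rewrite /d; lra.
have [r r0 rP] : exists2 r, 0 < r & forall q, hbox p r q ->
    v q < v p + d /\ forall i, v (hmul q (hpoint (a i) (b i) 0)) <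
                              v (hmul p (hpoint (a i) (b i) 0)) + d.
  suff /nbhs_hboxP[r r0 rP] : \forall q \near p, v q < v p + d /\
      forall i, v (hmul q (hpoint (a i) (b i) 0)) <
                v (hmul p (hpoint (a i) (b i) 0)) + d by exists r.
  apply: filterI; first by apply: vusc; lra.
  apply: (@filter_forall _ _ (fun i q => v (hmul q (hpoint (a i) (b i) 0)) <
                            v (hmul p (hpoint (a i) (b i) 0)) + d) (nbhs p) _) => i.
  by apply: near_hmul_plane (vusc _ _ _); rewrite ltrDl.
(* Chosen so that [psi q0 <= 2 * d] keeps [q0] within [r / 2] of [p] in each coordinate, leaving
   room for steps of size [r / 4]. *)
pose M := 8 * d / r ^+ 2.
have Mr : M * r ^+ 2 = 8 * d by rewrite divfK // gt_eqF // exprn_gt0.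
have M0 : 0 < M by rewrite divr_gt0 ?exprn_gt0; lra.
pose psi q := M * ((hx q - hx p) ^+ 2 + (hy q - hy p) ^+ 2 + (hz q - hz p) ^+ 2).
have psi0 q : 0 <= psi q by rewrite mulr_ge0 ?(ltW M0) // !addr_ge0 // sqr_ge0.
have psip : psi p = 0 by rewrite /psi !subrr; ring.
pose E := [set v q - psi q | q in hbox p r].
have pE : E (v p) by exists p; [split; rewrite subrr normr0|rewrite psip subr0].
have supE : has_sup E.
  split; first by exists (v p).
  exists (v p + d) => _ [q /rP[vq _] <-]; have := psi0 q; lra.
(* Bounds every coordinate of the displacement by [(a i, b i, 0)] from any point of the box; the
   vertical one depends on the base point. *)
pose L i := (1 + `|hx p| + `|hy p| + r) * (`|a i| + `|b i|).
have [t [t0 t1 td] [tL tM tconv]] : exists2 t : R, [/\ 0 < t, t <= 1 & t <= d] &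
  [/\ forall i, t * L i <= r / 4, forall i, t * (3 * M * L i ^+ 2 + 1) <= d &
   forall q i, v (hmul q (hpoint (t * a i) (t * b i) 0)) <=
     (1 - t) * v q + t * v (hmul q (hpoint (a i) (b i) 0))].
  have : \forall k \near \oo, 2 ^- k * 1 <= d /\
      ((forall i, 2 ^- k * L i <= r / 4) /\
       forall i, 2 ^- k * (3 * M * L i ^+ 2 + 1) <= d).
    apply: filterI; first exact: near_exp2N.
    apply: filterI.
      apply: (@filter_forall _ _ (fun i k => 2 ^- k * L i <= r / 4) \oo _) => i.
      by apply: near_exp2N; lra.
    apply: (@filter_forall _ _ (fun i k => 2 ^- k * (3 * M * L i ^+ 2 + 1) <= d) \oo _).
    by move=> i; apply: near_exp2N.
  move=> /filter_ex[k]; rewrite mulr1 => -[kd [kL kM]].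
  exists (2 ^- k); split=> //.
    by rewrite invf_le1 ?exprn_gt0// exprn_ege1// ler1n.
  by move=> q i; apply: hconvex_dyadic.
(* A maximizer up to [t ^+ 2] is enough, since the error is later divided by [t]. *)
have [_ [q0 [qx qy qz] <-]] := sup_adherent (exprn_gt0 2 t0) supE.
have lepsup q : hbox p r q -> v q - psi q <= sup E.
  by move=> pq; apply: sup_upper_bound => //; exists q.
move=> supq0.
have vp : v p <= v q0 - psi q0 + t ^+ 2.
  have : v p <= sup E by apply: sup_upper_bound.
  lra.
have tt : t ^+ 2 <= t by rewrite expr2 ger_pMl.
have psiq0 : psi q0 <= 2 * d.
  have [+ _] : v q0 < v p + d /\ _ := rP q0 (And3 qx qy qz).
  lra.
set X := hx q0 - hx p in qx; set Y := hy q0 - hy p in qy; set Z := hz q0 - hz p in qz.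
have half x : M * x ^+ 2 <= 2 * d -> `|x| <= r / 2.
  move=> Mx; rewrite -ler_sqr ?nnegrE ?divr_ge0 ?(ltW r0)//.
  rewrite real_normK ?num_real// -(ler_pM2l M0); nra.
have MX : 0 <= M * X ^+ 2 by rewrite mulr_ge0 ?sqr_ge0 ?ltW.
have MY : 0 <= M * Y ^+ 2 by rewrite mulr_ge0 ?sqr_ge0 ?ltW.
have MZ : 0 <= M * Z ^+ 2 by rewrite mulr_ge0 ?sqr_ge0 ?ltW.
have psiE : psi q0 = M * X ^+ 2 + M * Y ^+ 2 + M * Z ^+ 2 by rewrite /psi -/X -/Y -/Z; ring.
have Xr : `|X| <= r / 2 by apply: half; lra.
have Yr : `|Y| <= r / 2 by apply: half; lra.
have Zr : `|Z| <= r / 2 by apply: half; lra.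
(* [2 * M * D i] is the derivative of [psi] at [q0] in the i-th horizontal direction. As [q0] is
   common to all [i], it is linear in [(a i, b i)]. *)
pose D i := X * a i + Y * b i + Z * (2^-1 * (hx q0 * b i - a i * hy q0)).
have vq0 i : v q0 <= - (2 * M * (1 - t)) * D i
                    + v (hmul p (hpoint (a i) (b i) 0)) + 2 * d.
  set l := 2^-1 * (hx q0 * b i - a i * hy q0) in D *.
  have [aL bL lL] : [/\ `|a i| <= L i, `|b i| <= L i & `|l| <= L i].
    have : `|hx q0| <= `|hx p| + r.
      by rewrite -[hx q0](subrK (hx p)) (le_trans (ler_normD _ _))// addrC lerD2l ltW.
    have : `|hy q0| <= `|hy p| + r.
      by rewrite -[hy q0](subrK (hy p)) (le_trans (ler_normD _ _))// addrC lerD2l ltW.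
    have : `|l| <= 2^-1 * (`|hx q0| * `|b i| + `|a i| * `|hy q0|).
      by rewrite normrM gtr0_norm ?invr_gt0// -!normrM ler_pM2l ?invr_gt0// ler_normB.
    have := normr_ge0 (a i); have := normr_ge0 (b i).
    have := normr_ge0 (hx p); have := normr_ge0 (hy p).
    rewrite /L; move: `|a i| `|b i| `|hx p| `|hy p| `|l| `|hx q0| `|hy q0|.
    by move=> A B P Q l' P' Q' Q0 P0 B0 A0 hl hQ hP; split; nra.
  pose q := hmul q0 (hpoint (- t * a i) (- t * b i) 0).
  have tsmall x : `|x| <= L i -> `|t * x| <= r / 4.
    move=> xL; rewrite normrM gtr0_norm// (le_trans _ (tL i))//.
    by rewrite ler_pM2l.
  have box y x : `|y| <= r / 2 -> `|x| <= L i -> `|y - t * x| < r.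
    move=> yr /tsmall xr; rewrite (le_lt_trans (ler_normB _ _))//; lra.
  have qX : hx q - hx p = X - t * a i by rewrite /q hmul_planeE hxE /X; ring.
  have qY : hy q - hy p = Y - t * b i by rewrite /q hmul_planeE hyE /Y; ring.
  have qZ : hz q - hz p = Z - t * l.
    by rewrite /q hmul_planeE hzE /Z /l; field.
  have pq : hbox p r q by split; rewrite ?qX ?qY ?qZ; apply: box.
  have := lepsup _ pq.
  have [_ /(_ i)] := rP _ pq.
  have := tconv q i.
  rewrite {1}/q hmul_planeD addNr !mul0r hmul_plane0.
  move: (v q) (v (hmul q _)) (v (hmul p _)) => v1 v2 v3.
  have -> : psi q = psi q0 - 2 * M * t * D i + t ^+ 2 * (M * (a i ^+ 2 + b i ^+ 2 + l ^+ 2)).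
    by rewrite psiE /psi qX qY qZ /D -/l; ring.
  have sqL x : `|x| <= L i -> x ^+ 2 <= L i ^+ 2.
    by move=> xL; rewrite -[x ^+ 2]real_normK ?num_real// lerXn2r// nnegrE (le_trans _ xL).
  have := tM i.
  have NL : M * (a i ^+ 2 + b i ^+ 2 + l ^+ 2) <= 3 * M * L i ^+ 2.
    rewrite (_ : 3 * M * _ = M * (3 * L i ^+ 2)); last by ring.
    rewrite ler_pM2l//.
    by have := sqL _ aL; have := sqL _ bL; have := sqL _ lL; lra.
  have : 0 <= M * (a i ^+ 2 + b i ^+ 2 + l ^+ 2).
    by rewrite mulr_ge0 ?(ltW M0)// !addr_ge0// sqr_ge0.
  move: NL; set N := M * _; move=> NL N0 tML Hc H2 H1.
  rewrite -(ler_pM2l t0).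
  (* Near-maximality of [q0] bounds [v] at [q]: [N] is the second-order part of the penalty, and [1]
     accounts for the defect [t ^+ 2] in the supremum. *)
  have v1_le : (1 - t) * v1 <= (1 - t) * (v q0 - 2 * M * t * D i + t ^+ 2 * (N + 1)).
    rewrite ler_wpM2l ?subr_ge0//; lra.
  have v2_le : t * v2 <= t * (v3 + d) by rewrite ler_pM2l// ltW.
  have tN : t * (t * (N + 1)) <= t * d.
    rewrite ler_pM2l//; apply: le_trans tML; rewrite ler_pM2l//; lra.
  have tN0 : 0 <= t * (t ^+ 2 * (N + 1)).
    by rewrite !mulr_ge0 ?sqr_ge0 ?addr_ge0// ltW.
  lra.
have D0 : \sum_i c i * D i = 0.
  transitivity ((X - Z * 2^-1 * hy q0) * \sum_i c i * a i
              + (Y + Z * 2^-1 * hx q0) * \sum_i c i * b i).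
    rewrite !mulr_sumr -big_split/=; apply: eq_bigr => i _.
    by rewrite /D; field.
  by rewrite ca0 cb0 !mulr0 addr0.
have : \sum_i c i * v q0 <= \sum_i (- (2 * M * (1 - t)) * (c i * D i)
   + c i * v (hmul p (hpoint (a i) (b i) 0)) + c i * (2 * d)).
  apply: ler_sum => i _.
  rewrite (_ : _ + _ + _ = c i * (- (2 * M * (1 - t)) * D i
     + v (hmul p (hpoint (a i) (b i) 0)) + 2 * d)); last by ring.
  by rewrite ler_wpM2l.
rewrite !big_split/= -!mulr_suml -mulr_sumr c1 D0 mulr0 !mul1r add0r.
have := psi0 q0; rewrite /d in td *; lra.
Qed.

(* The combinations defining [hS u p], the points of the plane through [p] being
   parametrized by [h = (a, b, 0)]: the barycenter condition becomes linear in [h]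
   and independent of [p]. *)
Definition hcomb u p : set R := [set y | exists c a b : 'I_3 -> R,
  [/\ forall i, 0 <= c i <= 1, \sum_i c i = 1, \sum_i c i * a i = 0,
      \sum_i c i * b i = 0 & y = \sum_i c i * u (hmul p (hpoint (a i) (b i) 0))]].

Lemma hSE u p : hS u p = inf (hcomb u p).
Proof.
have sumE (c : 'I_3 -> R) (q : 'I_3 -> heis R) j :
    (\sum_i c i *: q i) ord0 j = \sum_i c i * q i ord0 j.
  by rewrite summxE; apply: eq_bigr => i _; rewrite mxE.
congr inf; apply/seteqP; split=> y.
- move=> [c [q [c01 qp c1 cq ->]]].
  have /choice[f fE] i : exists ab : R * R, q i = hmul p (hpoint ab.1 ab.2 0).
    by have [_ [a [b ->]] <-] := qp i; exists (a, b).
  exists c, (fun i => (f i).1), (fun i => (f i).2); split=> //.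
  + transitivity (hx p - (\sum_i c i) * hx p); last by rewrite c1 mul1r subrr.
    rewrite -{1}cq /hx sumE mulr_suml -sumrB; apply: eq_bigr => i _.
    by rewrite fE hmul_planeE -!/(hx _) hxE; ring.
  + transitivity (hy p - (\sum_i c i) * hy p); last by rewrite c1 mul1r subrr.
    rewrite -{1}cq /hy sumE mulr_suml -sumrB; apply: eq_bigr => i _.
    by rewrite fE hmul_planeE -!/(hy _) hyE; ring.
  + by apply: eq_bigr => i _; rewrite fE.
- move=> [c [a [b [c01 c1 ca0 cb0 ->]]]].
  exists c, (fun i => hmul p (hpoint (a i) (b i) 0)); split=> //.
    by move=> i; exists (hpoint (a i) (b i) 0) => //; exists (a i), (b i).
  apply: heis_eqP; rewrite /hx /hy /hz sumE -/(hx p) -/(hy p) -/(hz p).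
  + transitivity ((\sum_i c i) * hx p + \sum_i c i * a i).
      rewrite mulr_suml -big_split; apply: eq_bigr => i _ /=.
      by rewrite hmul_planeE -/(hx _) hxE; ring.
    by rewrite c1 ca0; ring.
  + transitivity ((\sum_i c i) * hy p + \sum_i c i * b i).
      rewrite mulr_suml -big_split; apply: eq_bigr => i _ /=.
      by rewrite hmul_planeE -/(hy _) hyE; ring.
    by rewrite c1 cb0; ring.
  (* Height on the plane through [p] is affine in [(a, b)], so the two moment conditions also fix
     the third coordinate. *)
  + transitivity ((\sum_i c i) * hz p + (2^-1 * hx p) * (\sum_i c i * b i)
                 - (2^-1 * hy p) * (\sum_i c i * a i)).
      rewrite mulr_suml !mulr_sumr -big_split -sumrB; apply: eq_bigr => i _ /=.
      by rewrite hmul_planeE -/(hz _) hzE; ring.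
    by rewrite c1 ca0 cb0; ring.
Qed.

(** Two points suffice, so the third weight is 0. This is the source of the h-convexity of the
    limit. *)
Lemma hcomb_midpoint u p a b :
  hcomb u p (2^-1 * u (hmul p (hpoint (- a) (- b) 0))
             + 2^-1 * u (hmul p (hpoint a b 0))).
Proof.
exists (fun i => [:: 2^-1; 2^-1; 0]`_i), (fun i => [:: - a; a; 0]`_i),
  (fun i => [:: - b; b; 0]`_i); split; rewrite ?big_ord_recl ?big_ord0 /=; try by field.
by move=> i; have [->|->|->] := ord3P i; apply/andP; split=> /=; lra.
Qed.

Lemma hcomb_self u p : hcomb u p (u p).
Proof.
have := hcomb_midpoint u p 0 0; rewrite oppr0 hmul_plane0.
by rewrite (_ : _ + _ = u p)//; field.
Qed.

Lemma hcomb_lbound u m p : (forall q, m <= u q) -> lbound (hcomb u p) m.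
Proof.
move=> mu _ [c [a [b [c01 c1 _ _ ->]]]].
rewrite -[m]mul1r -c1 mulr_suml; apply: ler_sum => i _.
by apply: ler_wpM2l => //; case/andP: (c01 i).
Qed.

Lemma hS_ge u m p : (forall q, m <= u q) -> m <= hS u p.
Proof.
move=> mu; rewrite hSE; apply: lb_le_inf; last exact: hcomb_lbound.
by exists (u p); exact: hcomb_self.
Qed.

Lemma hS_le_comb u m p y : (forall q, m <= u q) -> hcomb u p y -> hS u p <= y.
Proof.
move=> mu uy; rewrite hSE; apply: ge_inf => //.
by exists m; exact: hcomb_lbound.
Qed.

Lemma hS_le u m p : (forall q, m <= u q) -> hS u p <= u p.
Proof. by move=> mu; apply: hS_le_comb mu _; exact: hcomb_self. Qed.

(** A nearly optimal combination at [p] can be transported to nearby [q]: the conditions on weights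
    and displacements do not involve the base point. *)
Lemma hS_usc u m : (forall q, m <= u q) ->
  upper_semicontinuous u -> upper_semicontinuous (hS u).
Proof.
move=> mu uusc p e; rewrite hSE => /inf_lt[]; first by exists (u p); exact: hcomb_self.
move=> _ [c [a [b [c01 c1 ca0 cb0 ->]]]] ye.
set y := \sum_i _ in ye; pose d := e - y; have d0 : 0 < d by rewrite subr_gt0.
have near_d : \forall q \near p, forall i, u (hmul q (hpoint (a i) (b i) 0)) <
                                    u (hmul p (hpoint (a i) (b i) 0)) + d / 2.
  apply: (@filter_forall _ _ (fun i q => u (hmul q (hpoint (a i) (b i) 0)) <
                      u (hmul p (hpoint (a i) (b i) 0)) + d / 2) (nbhs p) _) => i.
  by apply: near_hmul_plane (uusc _ _ _); rewrite ltrDl divr_gt0.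
apply: filterS near_d => q qd.
apply: (@le_lt_trans _ _ (\sum_i c i * u (hmul q (hpoint (a i) (b i) 0)))).
  by apply: hS_le_comb mu _; exists c, a, b.
apply: (@le_lt_trans _ _ (y + d / 2)); last by rewrite /d; lra.
rewrite (_ : d / 2 = (\sum_i c i) * (d / 2)); last by rewrite c1 mul1r.
rewrite mulr_suml -big_split; apply: ler_sum => i _ /=.
by rewrite -mulrDr ler_wpM2l ?(ltW (qd i))//; case/andP: (c01 i).
Qed.

(** One induction step of the comparison of [v] with all iterates. *)
Lemma hconvex_le_hS v u p : hconvex v -> (forall q, v q <= u q) -> v p <= hS u p.
Proof.
move=> vconv vu; rewrite hSE; apply: lb_le_inf; first by exists (u p); exact: hcomb_self.
move=> _ [c [a [b [c01 c1 ca0 cb0 ->]]]].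
have c0 i : 0 <= c i by case/andP: (c01 i).
apply: (le_trans (hconvex_barycenter _ _ p _ _ _ vconv c0 c1 ca0 cb0)).
by apply: ler_sum => i _; rewrite ler_wpM2l.
Qed.

End HConvex.

(** * Convergence of the iterates and identification of the limit *)

Theorem theorem4p8 (R : realType) (u : heis R -> R)
    (u_cont : continuous u) (u_bounded_below : has_lbound (range u)) :
  (forall p : heis R, cvgn (fun n : nat => iter n (@hS R) u p)) /\
  (forall p : heis R, hconvex_envelope u p = hS_limit u p).
Proof.
have [m mrange] := u_bounded_below.
have mu q : m <= u q by apply: mrange; exists q.
have mS n q : m <= iter n (@hS R) u q.
  by elim: n q => [//|n IH] q; exact: hS_ge.
have S_anti p : {homo (fun n => iter n (@hS R) u p) : i j / (i <= j)%N >-> j <= i}.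
  by apply/nonincreasing_seqP => n; exact: hS_le (mS n).
have S_cvg p : cvgn (fun n => iter n (@hS R) u p).
  by apply: nonincreasing_is_cvgn => //; exists m => _ [n _ <-]; exact: mS.
have S_usc n : upper_semicontinuous (iter n (@hS R) u).
  elim: n => [|n IH]; last exact: hS_usc (mS n) IH.
  by move=> p a upa; exact: (cvgr_lt _ (u_cont p)).
have U_le n p : hS_limit u p <= iter n (@hS R) u p.
  exact: nonincreasing_cvgn_ge.
have le_U v p : hconvex v -> (forall q, v q <= u q) -> v p <= hS_limit u p.
  move=> vconv vu; apply: limr_ge => //; apply: nearW => n.
  by elim: n p => [|n IH] p; [exact: vu|exact: hconvex_le_hS].
have U_conv : hconvex (hS_limit u).
  split=> [p e Upe|p _ [a [b ->]]].
    (* Some iterate is already below [e] at [p], hence near [p], and it dominates the limit. *)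
    have [n nP] := filter_ex (cvgr_lt _ (S_cvg p) _ Upe).
    by apply: filterS (S_usc n p e nP) => q; exact: le_lt_trans.
  rewrite hinv_planeE.
  suff : hS_limit u p <= 2^-1 * hS_limit u (hmul p (hpoint (- a) (- b) 0))
                         + 2^-1 * hS_limit u (hmul p (hpoint a b 0)) by lra.
  apply: (@ler_cvg_to _ \oo _ _ (fun=> hS_limit u p) _ _ _ (cvg_cst _)).
    by apply: cvgD; apply: cvgMr; exact: S_cvg.
  (* The index shift matters: iterate [n.+1] at [p] is at most the midpoint average of iterate [n],
     and only then does [n] tend to infinity. *)
  apply: nearW => n; apply: (le_trans (U_le n.+1 p)).
  by apply: hS_le_comb (mS n) _; exact: hcomb_midpoint.
split=> // p; apply/eqP; rewrite eq_le; apply/andP; split.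
  apply: ge_sup; last by move=> _ [v [vconv vu] <-]; exact: le_U.
  by exists (hS_limit u p), (hS_limit u) => //; split=> // q; exact: (U_le 0).
apply: sup_upper_bound.
  split; first by exists (hS_limit u p), (hS_limit u) => //; split=> // q; exact: (U_le 0).
  by exists (hS_limit u p) => _ [v [vconv vu] <-]; exact: le_U.
by exists (hS_limit u) => //; split=> // q; exact: (U_le 0).
Qed.
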